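(* Let $r,z,k\ge 1$ be integers. The excess $\epsilon$ of any $(r,z,k)$-cage satisfies $$\epsilon \geq \frac{rz}{(2r+3z)\phi}\left[\frac{\lambda_1^{k-1}-1}{\lambda_1-1}-\frac{\lambda_2^{k-1}-1}{\lambda_2-1}\right],$$ where $\phi=\sqrt{(r+z-1)^2+4z}$, $\lambda_1=\frac12(r+z-1+\phi)$ and $\lambda_2=\frac12(r+z-1-\phi)$.
   Context: A (finite) mixed graph $G$ consists of a vertex set $V(G)$, a set of undirected edges and a set of directed arcs (ordered pairs of vertices). Loops are forbidden, as are parallel edges and arcs. Write $u\sim v$ if there is an edge between $u$ and $v$, and $u\to v$ if there is an arc from $u$ to $v$. The undirected degree of $u$ is the number of edges incident with $u$; the directed out-degree of $u$ is the number of arcs with initial vertex $u$. A walk of length $\ell$ from $u_0$ to $u_\ell$ is a sequence $u_0u_1\dots u_\ell$ of vertices such that for each $0\le i\le \ell-1$ either $u_i\sim u_{i+1}$ or $u_i\to u_{i+1}$. A mixed path is a non-backtracking walk, i.e. a walk that never traverses an edge and then immediately retraces it (no $u_i\sim u_{i+1}\sim u_i$); walks of length $0$ are allowed. $G$ is $k$-geodetic if for every ordered pair $(u,v)$ of (not necessarily distinct) vertices there is at most one mixed path from $u$ to $v$ of length $\le k$. The mixed Moore bound $M(r,z,k)$ is the number of vertices of the mixed Moore tree of depth $k$: $M(r,z,k)=1+\sum_{t=1}^{k}(E_t+D_t)$, where $E_1=r$, $D_1=z$, $E_{t+1}=(r-1)E_t+rD_t$ and $D_{t+1}=z(E_t+D_t)$.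 An $(r,z,k;+\epsilon)$-graph is a $k$-geodetic mixed graph with minimum undirected degree $r$, minimum directed out-degree $z$ and order $M(r,z,k)+\epsilon$; $\epsilon$ is its excess. An $(r,z,k)$-cage (geodetic cage) is such a graph with smallest possible excess for the given $r,z,k$. Total regularity is not assumed. *)

(* Defs.v *)
From mathcomp Require Import all_boot all_order all_algebra.
From mathcomp Require Import reals.

Set Implicit Arguments.
Unset Strict Implicit.
Unset Printing Implicit Defensive.

Import Order.TTheory GRing.Theory Num.Theory.

(* An edge excludes an arc in either direction between the same two vertices
   (the other direction follows from [uedge_sym]).  A pair of opposite arcs
   is not a pair of parallel arcs, and is not excluded here. *)
Record mixedGraph := MixedGraph {
  vertex :> finType;
  uedge : rel vertex;
  darc : rel vertex;
  uedge_sym : symmetric uedge;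
  uedge_irr : irreflexive uedge;
  darc_irr : irreflexive darc;
  uedge_darc_disj : forall u v, uedge u v -> ~~ darc u v
}.

Definition undirected_degree (G : mixedGraph) (u : G) : nat :=
  #|[set v | uedge u v]|.

Definition out_degree (G : mixedGraph) (u : G) : nat :=
  #|[set v | darc u v]|.

Definition is_minimum (T : Type) (f : T -> nat) (m : nat) : Prop :=
  (forall x, (m <= f x)%N) /\ exists x, f x = m.

Definition step (G : mixedGraph) : rel G := fun u v => uedge u v || darc u v.

(* The vertex sequence u_0 u_1 ... u_l is represented by its head u_0 and its
   tail p = [:: u_1; ...; u_l], so that its length as a walk is [size p] and
   its final vertex is [last u_0 p]. *)
Definition walk (G : mixedGraph) (u : G) (p : seq G) : bool := path (@step G) u p.

Fixpoint nonbacktracking (G : mixedGraph) (u : G) (p : seq G) : bool :=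
  if p is v :: p' then
    (if p' is w :: _ then ~~ [&& uedge u v, uedge v w & w == u] else true)
    && nonbacktracking v p'
  else true.

Definition mixed_path (G : mixedGraph) (u : G) (p : seq G) : bool :=
  walk u p && nonbacktracking u p.

Definition geodetic (k : nat) (G : mixedGraph) : Prop :=
  forall (u v : G) (p q : seq G),
    mixed_path u p -> last u p = v -> (size p <= k)%N ->
    mixed_path u q -> last u q = v -> (size q <= k)%N ->
    p = q.

(* [moore_level r z t] is the pair (E_{t+1}, D_{t+1}): the index is shifted so
   that the recursion starts at level 1 of the Moore tree.  The truncated
   subtraction [r.-1] is r - 1 since r >= 1 throughout. *)
Fixpoint moore_level (r z t : nat) : nat * nat :=
  if t is t'.+1 then
    let: (E, D) := moore_level r z t' in
    (r.-1 * E + r * D, z * (E + D))%N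
  else (r, z).

Definition moore_bound (r z k : nat) : nat :=
  (1 + \sum_(t < k) ((moore_level r z t).1 + (moore_level r z t).2))%N.

(* The excess is an integer: its nonnegativity is not built in. *)
Definition is_excess_graph (r z k : nat) (eps : int) (G : mixedGraph) : Prop :=
  [/\ geodetic k G,
      is_minimum (@undirected_degree G) r,
      is_minimum (@out_degree G) z
    & (#|G|%:Z = (moore_bound r z k)%:Z + eps)%R].

Definition is_cage (r z k : nat) (eps : int) (G : mixedGraph) : Prop :=
  is_excess_graph r z k eps G /\
  forall (eps' : int) (H : mixedGraph),
    is_excess_graph r z k eps' H -> (eps <= eps')%R.

(* Main.v *)
Require Import Defs.
From mathcomp Require Import all_boot all_order all_algebra.
From mathcomp Require Import boolp reals.
From mathcomp Require Import zify ring lra.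

Set Implicit Arguments.
Unset Strict Implicit.
Unset Printing Implicit Defensive.

Import Order.TTheory GRing.Theory Num.Theory.

(** The excess is bounded by counting arcs in two ways: the sum of the
    in-degrees equals the sum of the out-degrees, yet geodecity gives many
    vertices an in-degree above the average, unless many pairs of vertices are
    too far apart.  Let n be the order and M the Moore bound, let ball x m be
    the set of vertices reached from x by a mixed path with fewer than m steps,
    and let edge_tree m be the number of vertices of depth less than m in the
    Moore tree hanging from the far end of an edge.

    If some vertex has more than r edges or more than z out-arcs, then the tree
    rooted at it has an additional branch, so n >= M + edge_tree k
    ([excess_bound_irregular]), which is more than enough.

    Otherwise every vertex has exactly r edges and z out-arcs, and each vertex
    misses, that is, does not reach by a mixed path of length at most k, at most
    n - M vertices.  Fix a vertex u.  A neighbour x of u (along an edge or an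
    arc) that reaches y gives a predecessor s of y, namely the last vertex but
    one of the walk from u through x to y; by geodecity s determines the path
    from u to s, hence x, so distinct x give distinct predecessors.
    - If y is not at distance less than k from u, this produces r + z
      predecessors of y, up to the neighbours x of u that miss y.  At most r of
      the predecessors are joined to y by an edge, so the others are joined to
      it by an arc ([indegree_far]).
    - If y is at distance less than k from u on a path that begins with an edge,
      and u -> x, then the predecessor s is joined to y by an arc, because an
      edge between y and s would turn the short path to y into a second path
      from u to s.  Moreover s is not the end of a short path from u beginning
      with an edge.  So y has, up to the x that miss it, z in-arcs besides those
      that come from such ends ([indegree_edge_side]).
    - If y is at distance less than k from u, on a path that does not begin with
      an edge, take u ~ w -> b: since w reaches y through u, it cannot reach y
      through b as well, so y is not at distance less than k from b
      ([arc_side_far]), and the first case applies to b.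

    Let S be the set of ends of paths of length at most k - 2 from u that begin
    with an edge; it has at least r * edge_tree (k - 2) elements.  In all cases
    the in-degree of y is at least z, plus the number of arcs from S to y, minus
    the number of neighbours of u and of b that miss y ([indegree_bound]).  The
    sum of the in-degrees over all y is n z, hence z |S| <= 2 (r + z) (n - M).

    Finally lambda1 and lambda2 are the roots of the characteristic equation of
    the recurrence satisfied by the increments of edge_tree, and the bracket in
    the theorem is phi * edge_tree (k - 2) ([edge_tree_closed_form]). *)

(** * Sizes of Moore trees *)

(** Vertices of depth less than m in the Moore tree whose root has been entered
    through an edge, so that this edge cannot be used again, and in the full
    Moore tree. *)
Fixpoint edge_tree (r z m : nat) : nat :=
  if m is m'.+1 then 1 + r.-1 * edge_tree r z m' + z * full_tree r z m' else 0
with full_tree (r z m : nat) : nat :=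
  if m is m'.+1 then 1 + r * edge_tree r z m' + z * full_tree r z m' else 0.

Lemma moore_bound_full_tree r z k : (1 <= r)%N ->
  moore_bound r z k = full_tree r z k.+1.
Proof.
move=> r_gt0; rewrite /moore_bound big_split /= addnA.
(* The levels E_t and D_t, which sort the paths by their last step, are as large
   as the levels of r copies of edge_tree and of z copies of full_tree, which
   sort them by their first step: reversing a path exchanges the two. *)
have [-> ->] : \sum_(t < k) (moore_level r z t).1 = r * edge_tree r z k /\
               \sum_(t < k) (moore_level r z t).2 = z * full_tree r z k.
  elim: k => [|k [IH1 IH2]]; first by rewrite !big_ord0 !muln0.
  rewrite !big_ord_recl /=; split.
    under eq_bigr do rewrite (surjective_pairing (moore_level _ _ _)) /=.
    rewrite big_split /= -!big_distrr /= IH1 IH2; nia.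
  under eq_bigr do rewrite (surjective_pairing (moore_level _ _ _)) /=.
  rewrite -big_distrr /= big_split /= IH1 IH2; nia.
by [].
Qed.

(** The full tree has one more edge branch at its root. *)
Lemma full_treeE r z m : (1 <= r)%N ->
  full_tree r z m.+1 = edge_tree r z m.+1 + edge_tree r z m.
Proof. move=> r_gt0 /=; nia. Qed.

Lemma leq_edge_full_tree r z m : edge_tree r z m <= full_tree r z m.
Proof. by case: m => //= m; rewrite leq_add2r leq_add2l leq_mul2r leq_pred orbT. Qed.

Lemma edge_tree_rec r z m : 1 <= r ->
  edge_tree r z m.+2 = 1 + (r + z - 1) * edge_tree r z m.+1 + z * edge_tree r z m.
Proof.
move=> r_gt0; have := full_treeE z m r_gt0; have := leq_edge_full_tree r z m.+1.
rewrite [edge_tree r z m.+2]/= -/(edge_tree r z m.+1) -/(full_tree r z m.+1).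
move: (edge_tree _ _ _) (edge_tree _ _ _) (full_tree _ _ _) => e1 e0 n1; nia.
Qed.

(** The root of edge_tree k carries z arc branches, each of which carries r edge
    branches of depth k - 2. *)
Lemma edge_tree_growth r z k :
  r * z * edge_tree r z (k - 2) <= edge_tree r z k.
Proof.
case: k => [|[|k]]; rewrite ?muln0 // -addn2 addnK addn2.
rewrite [edge_tree _ _ k.+2]/= -/(full_tree r z k.+1) -/(edge_tree r z k.+1).
have : r * edge_tree r z k <= full_tree r z k.+1 by rewrite /= -addnA addnCA leq_addr.
nia.
Qed.

(** * Enumeration of mixed paths *)

Section Paths.
Variables (G : mixedGraph).
Implicit Types (u v w x y s : G) (p q : seq G) (o : option G).

(** The option o holds the vertex from which u has just been entered through an
    edge, if any: the walk must not return there through this edge. *)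
Definition allowed o u v := step u v && ~~ (uedge u v && (o == Some v)).

(** The Moore tree at u, each vertex being represented by the path that leads to
    it. *)
Fixpoint tree_paths o u m : seq (seq G) :=
  if m is m'.+1 then
    [::] :: [seq v :: p | v <- enum (allowed o u),
                          p <- tree_paths (if uedge u v then Some u else None) v m']
  else [::].

Definition edge_paths u m : seq (seq G) :=
  [seq v :: p | v <- enum (uedge u), p <- tree_paths (Some u) v m].

Definition starts_off o u p :=
  if p is v :: _ then ~~ (uedge u v && (o == Some v)) else true.

Lemma darc_not_uedge u v : darc u v -> uedge u v = false.
Proof. by move=> uv; apply/negP => /uedge_darc_disj/negP. Qed.

Lemma mixed_path_cons u v p :
  mixed_path u (v :: p) =
  [&& step u v, mixed_path v p & starts_off (if uedge u v then Some u else None) v p].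
Proof.
rewrite /mixed_path /walk /=.
case: (step u v) => //=; case: (path _ v p) => //=.
rewrite andbC; congr andb; case: p => //= w p.
by case: (uedge u v) => /=; rewrite ?andbF // (inj_eq Some_inj) eq_sym.
Qed.

Lemma tree_pathsP o u m p :
  (p \in tree_paths o u m) = [&& size p < m, mixed_path u p & starts_off o u p].
Proof.
elim: m => //= m IH in o u p *; rewrite inE.
case: p => [|v p] //=; rewrite mixed_path_cons ltnS.
apply/allpairsPdep/idP => [[v' [p' [+ + [-> ->]]]]|].
  by rewrite mem_enum IH => /andP[-> ->] /and3P[-> -> ->].
move=> /and3P[size_p /and3P[uv mp so] off]; exists v, p; split => //.
  by rewrite mem_enum; apply/andP.
by rewrite IH size_p mp so.
Qed.

Lemma tree_paths_uniq o u m : uniq (tree_paths o u m).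
Proof.
elim: m => //= m IH in o u *; apply/andP; split.
  by apply/negP => /allpairsPdep[? [? []]].
apply: allpairs_uniq_dep => [|v _|[v p] [v' p'] _ _ [? ?]]; rewrite ?enum_uniq //.
by subst.
Qed.

Lemma edge_pathsP u m p :
  reflect (exists v p', [/\ p = v :: p', uedge u v, mixed_path u p & size p <= m])
          (p \in edge_paths u m).
Proof.
apply: (iffP allpairsPdep) => [[v [p' [+ + ->]]]|[v [p' [-> uv]]]].
  rewrite mem_enum tree_pathsP => uv /and3P[sp mp so]; exists v, p'; split => //.
  by rewrite mixed_path_cons /step [uedge u v]uv mp so.
rewrite mixed_path_cons /step uv /= => /andP[mp so] sp; exists v, p'.
by split=> //; rewrite ?mem_enum // tree_pathsP sp mp so.
Qed.

Lemma edge_paths_uniq u m : uniq (edge_paths u m).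
Proof.
apply: allpairs_uniq_dep => [|v _|[v p] [v' p'] _ _ [? ?]];
  rewrite ?enum_uniq ?tree_paths_uniq //.
by subst.
Qed.

Lemma sum_allowed o u (F : G -> nat) :
  \sum_(v | allowed o u v) F v =
  \sum_(v | uedge u v && (o != Some v)) F v + \sum_(v | darc u v) F v.
Proof.
rewrite (bigID (uedge u)) /=; congr addn; apply: eq_bigl => v; rewrite /allowed /step.
  by case: (uedge u v); rewrite /= ?andbF ?andbT.
by case: (boolP (uedge u v)) => [/uedge_darc_disj/negbTE ->|_]; rewrite ?andbF ?andbT.
Qed.

Lemma size_tree_paths_rec o u m :
  size (tree_paths o u m.+1) =
  1 + (\sum_(v | uedge u v && (o != Some v)) size (tree_paths (Some u) v m)
       + \sum_(v | darc u v) size (tree_paths None v m)).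
Proof.
rewrite /= size_allpairs_dep sumnE big_map big_enum add1n /=; congr _.+1.
rewrite sum_allowed; congr addn; apply: eq_bigr => v.
  by move=> /andP[-> _].
move=> uv; case: ifP => // /uedge_darc_disj; by rewrite uv.
Qed.

(** * Counting paths under minimum degree conditions *)

Section MinDegree.
Variables r z : nat.
Hypothesis und_ge : forall u, r <= undirected_degree u.
Hypothesis out_ge : forall u, z <= out_degree u.

Lemma size_tree_paths m o u :
  (if o is Some _ then edge_tree r z m else full_tree r z m) <= size (tree_paths o u m).
Proof.
elim: m => [|m IH] in o u *; first by case: o.
rewrite size_tree_paths_rec.
have arcs : z * full_tree r z m <= \sum_(v | darc u v) size (tree_paths None v m).
  apply: (@leq_trans (\sum_(v | darc u v) full_tree r z m)); last first.
    by apply: leq_sum => v _; exact: (IH None).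
  by rewrite sum_nat_cond_const; exact: leq_mul (out_ge u) (leqnn _).
pose d := #|[set v | uedge u v && (o != Some v)]|.
have edges : d * edge_tree r z m <=
    \sum_(v | uedge u v && (o != Some v)) size (tree_paths (Some u) v m).
  apply: (@leq_trans (\sum_(v | uedge u v && (o != Some v)) edge_tree r z m)).
    by rewrite sum_nat_cond_const.
  by apply: leq_sum => v _; exact: (IH (Some u)).
suff d_ge : (if o is Some _ then r.-1 else r) <= d.
  apply: (@leq_trans (1 + (d * edge_tree r z m + z * full_tree r z m))).
    by have := leq_mul d_ge (leqnn (edge_tree r z m)); case: (o) => [w|] /=; lia.
  by rewrite leq_add2l leq_add.
rewrite /d; case: (o) => [w|].
  have := und_ge u; rewrite /undirected_degree (cardsD1 w).
  suff -> : [set v | uedge u v] :\ w = [set v | uedge u v && (Some w != Some v)].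
    case: (_ \in _) => /=; lia.
  by apply/setP => v; rewrite !inE (inj_eq Some_inj) andbC eq_sym.
apply: leq_trans (und_ge u) _; apply/subset_leq_card/subsetP => v.
by rewrite !inE => ->.
Qed.

Lemma size_root_paths m u :
  1 + undirected_degree u * edge_tree r z m + out_degree u * full_tree r z m
    <= size (tree_paths None u m.+1).
Proof.
rewrite size_tree_paths_rec -addnA leq_add2l leq_add //.
  rewrite -sum_nat_const; under eq_bigl do rewrite inE.
  rewrite [X in _ <= X](eq_bigl (uedge u)); last by move=> v; rewrite andbT.
  by apply: leq_sum => v _; exact: (size_tree_paths m (Some u)).
rewrite -sum_nat_const; under eq_bigl do rewrite inE.
by apply: leq_sum => v _; exact: (size_tree_paths m None).
Qed.

Lemma size_edge_paths m u : r * edge_tree r z m <= size (edge_paths u m).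
Proof.
rewrite size_allpairs_dep sumnE big_map big_enum /=.
apply: (@leq_trans (\sum_(v | uedge u v) edge_tree r z m)).
  by rewrite sum_nat_cond_const; exact: leq_mul (und_ge u) (leqnn _).
by apply: leq_sum => v _; exact: (size_tree_paths m (Some u)).
Qed.
End MinDegree.

(** * Prolonging a path at its end *)

Lemma mixed_path_rconsW u p y : mixed_path u (rcons p y) ->
  mixed_path u p /\ step (last u p) y.
Proof.
rewrite /mixed_path /walk rcons_path => /andP[/andP[-> ->] nb]; split=> //=.
elim: p u nb => [|v p IH] u //= /andP[nb /IH ->]; rewrite andbT.
by case: p nb {IH}.
Qed.

Lemma mixed_path_rcons2 u p y s :
  mixed_path u (rcons (rcons p y) s) =
  [&& mixed_path u (rcons p y), step y s &
      ~~ [&& uedge (last u p) y, uedge y s & s == last u p]].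
Proof.
rewrite /mixed_path /walk rcons_path last_rcons.
case: (path _ u (rcons p y)) => //=; case: (step y s) => //=; last by rewrite andbF.
elim: p u => [|v p IH] u; first by rewrite /= !andbT.
rewrite rcons_cons /= {}IH andbA; congr (_ && _ && _).
by case: p => [|w p] //.
Qed.

Lemma mixed_path_rcons_darc u p y :
  mixed_path u p -> darc (last u p) y -> mixed_path u (rcons p y).
Proof.
case/lastP: p => [|p x] mp; rewrite ?last_rcons => xy.
  by rewrite /mixed_path /walk /= /step xy orbT.
by rewrite mixed_path_rcons2 mp /step xy orbT (darc_not_uedge xy) andbF.
Qed.

(** * Balls and predecessors in a geodetic graph *)

Definition ends u (L : seq (seq G)) : {set G} := [set v in map (last u) L].
Definition ball u m := ends u (tree_paths None u m).
Definition edge_ball u m := ends u (edge_paths u m).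

Lemma ballP u m v :
  reflect (exists p, [/\ mixed_path u p, last u p = v & size p < m]) (v \in ball u m).
Proof.
rewrite inE; apply: (iffP mapP) => [[p pT ->]|[p [mp <- sp]]]; exists p => //.
  by move: pT; rewrite tree_pathsP => /and3P[].
by rewrite tree_pathsP sp mp; case: (p) => //= w q; rewrite andbF.
Qed.

Lemma edge_ballP u m y :
  reflect (exists v p, [/\ uedge u v, mixed_path u (v :: p), last v p = y & size p < m])
          (y \in edge_ball u m).
Proof.
rewrite inE; apply: (iffP mapP) => [[p /edge_pathsP[v [p' [-> ? ? ?]]] ->]|].
  by exists v, p'.
move=> [v [p [uv mp yE sp]]]; exists (v :: p); rewrite //=; apply/edge_pathsP.
by exists v, p.
Qed.

Section Geodetic.
Variable k : nat.
Hypothesis geoG : geodetic k G.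

Lemma card_ends u (L : seq (seq G)) : uniq L ->
  {in L, forall p, mixed_path u p /\ size p <= k} -> #|ends u L| = size L.
Proof.
move=> L_uniq LP; rewrite cardsE -(size_map (last u)); apply/card_uniqP.
rewrite map_inj_in_uniq // => p q /LP[mp sp] /LP[mq sq] e.
exact: (geoG mp e sp mq erefl sq).
Qed.

Lemma card_ball u : #|ball u k.+1| = size (tree_paths None u k.+1).
Proof.
apply: card_ends (tree_paths_uniq _ _ _) _ => p.
by rewrite tree_pathsP => /and3P[].
Qed.

Lemma card_edge_ball u m : m <= k -> #|edge_ball u m| = size (edge_paths u m).
Proof.
move=> mk; apply: card_ends (edge_paths_uniq _ _) _ => p.
move=> /edge_pathsP[? [? [_ _ mp sp]]]; split=> //; exact: leq_trans mk.
Qed.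

Lemma leq_card_injrel (A B : {set G}) (R : G -> G -> Prop) :
  {in A, forall x, exists2 s, s \in B & R x s} ->
  (forall x x' s, R x s -> R x' s -> x = x') -> #|A| <= #|B|.
Proof.
move=> exR injR.
have /choice[f fP] : forall x, exists s, x \in A -> s \in B /\ R x s.
  move=> x; have [/exR[s sB Rxs]|_] := boolP (x \in A); first by exists s.
  by exists x.
rewrite -(@card_in_imset _ _ f) => [|x x' /fP[_ Rx] /fP[_ Rx'] e]; last first.
  by apply: injR Rx _; rewrite e.
by apply/subset_leq_card/subsetP => _ /imsetP[x /fP[? _] ->].
Qed.

(** The vertex s is the last but one, and x the first after u, on a walk from u
    to y.  The path q stops at s, so [head y q] is x even when q is empty: then s
    is u, and x is y itself. *)
Definition penultimate u y x s :=
  exists q, [/\ mixed_path u q, size q <= k, last u q = s & head y q = x].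

Lemma penultimate_inj u y x x' s :
  penultimate u y x s -> penultimate u y x' s -> x = x'.
Proof.
by move=> [q [mq sq lq <-]] [q' [mq' sq' lq' <-]]; rewrite (geoG mq lq sq mq' lq' sq').
Qed.

Lemma penultimate_path u x p : mixed_path u (x :: p) -> size p <= k ->
  exists s, step s (last x p) /\ penultimate u (last x p) x s.
Proof.
rewrite lastI -/(last x p) => /mixed_path_rconsW[mq st] sp.
exists (last u (belast x p)); split=> //; exists (belast x p).
by split; rewrite ?size_belast //; case: (p).
Qed.

(** A neighbour x of u that reaches y gives a walk from u through x to y, and its
    last vertex but one is a predecessor of y.  The walk does not go back through
    the edge u ~ x: otherwise its part after the return to u would bring y too
    close to u. *)
Lemma indegree_far u y : y \notin ball u k ->
  #|[set x | step u x & y \in ball x k.+1]| <= #|[set s | step s y]|.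
Proof.
move=> y_far; apply: (leq_card_injrel (R := penultimate u y)); last first.
  exact: penultimate_inj.
move=> x; rewrite inE => /andP[ux /ballP[p [mp yE sp]]].
have [|s [sy Rs]] := @penultimate_path u x p _ sp.
  rewrite mixed_path_cons ux mp /=; case: p mp yE sp => //= v p mp yE sp.
  case: (uedge u x) => /=; last by rewrite andbF.
  apply/negP => /andP[_ /eqP[uv]]; case/negP: y_far; apply/ballP; exists p.
  by subst v; move: mp; rewrite mixed_path_cons => /and3P[].
by rewrite -yE in Rs *; exists s; rewrite // inE.
Qed.

Lemma mixed_path_darc u v p : darc u v -> mixed_path v p -> mixed_path u (v :: p).
Proof.
move=> uv mp; rewrite mixed_path_cons /step uv orbT mp darc_not_uedge //=.
by case: (p) => //= w ?; rewrite andbF.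
Qed.

(** If the predecessor s of y found through x were joined to y by an edge, then
    this edge would either prolong the short path to y or be its last step; in
    both cases s would be reached from u by a path that begins with an edge,
    while the unique short path to s begins with the arc to x or is empty. *)
Lemma indegree_edge_side u y : y \in edge_ball u k.-1 ->
  #|[set x | darc u x & y \in ball x k.+1]| <=
  #|[set s | darc s y & s \notin edge_ball u (k - 2)]|.
Proof.
move=> /edge_ballP[w [P [uw mP PE sP]]].
apply: (leq_card_injrel (R := penultimate u y)); last exact: penultimate_inj.
move=> x; rewrite inE => /andP[ux /ballP[p [mp yE sp]]].
have [s [sy Rs]] := penultimate_path (mixed_path_darc ux mp) sp.
rewrite yE in sy Rs; exists s => //.
have [q [mq sq lq xE]] := Rs.
have x_not_edge v : uedge u v -> x != v.
  by move=> uv; apply: contraTneq uv => <-; rewrite darc_not_uedge.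
have no_edge_path v q' : uedge u v -> mixed_path u (v :: q') -> size q' < k ->
    last v q' <> s.
  move=> uv mq' sq' lq'; case/eqP: (x_not_edge _ uv).
  by rewrite -xE (geoG mq lq sq mq' lq' sq').
rewrite inE; apply/andP; split; last first.
  apply/negP => /edge_ballP[v [q' [uv mq' lq' sq']]].
  by apply: (no_edge_path v q') => //; lia.
case/orP: sy => // sy; exfalso.
(* Either w :: P can be prolonged to s, or it came to y from s through this very
   edge, and then its part up to s is q. *)
have := mixed_path_rcons2 u (belast w P) y s.
rewrite -{1 2}PE -lastI mP /step uedge_sym sy /=.
case: eqP => [sE _|_]; last first.
  rewrite !andbF => mPs; apply: (no_edge_path w (rcons P s) uw mPs).
    by rewrite size_rcons; lia.
  by rewrite last_rcons.
have [mB _] : mixed_path u (belast w P) /\ step (last u (belast w P)) y.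
  by apply: mixed_path_rconsW; rewrite -PE -lastI.
have sB : size (belast w P) <= k by rewrite size_belast; lia.
have qE := geoG mq lq sq mB (esym sE) sB.
case/eqP: (x_not_edge w uw); rewrite -xE qE.
by case: (P) PE => //= ->.
Qed.

(** From w, the vertex y is reached through u by a path of length at most k, so
    it cannot be reached through b as well. *)
Lemma arc_side_far u w b y : uedge u w -> darc w b ->
  y \in ball u k -> y \notin edge_ball u k.-1 -> y \notin ball b k.
Proof.
move=> uw wb /ballP[P [mP PE sP]] y_edge; apply/negP => /ballP[p [mp pE sp]].
have mQ : mixed_path w (u :: P).
  rewrite mixed_path_cons /step uedge_sym uw mP /=.
  case: P mP PE sP => //= v P mP PE sP; apply/negP => /andP[uv _].
  by case/negP: y_edge; apply/edge_ballP; exists v, P; split=> //; lia.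
have [ub _] := geoG mQ PE sP (mixed_path_darc wb mp) pE sp.
by move: (darc_not_uedge wb); rewrite -ub uedge_sym uw.
Qed.

(** * Double counting of arcs *)

Definition unreached u y := #|[set x | step u x & y \notin ball x k.+1]|.

Lemma card_step_out u : #|[set x | step u x]| = undirected_degree u + out_degree u.
Proof.
rewrite -cardsUI [X in _ = _ + X]eq_card0 ?addn0.
  by apply: eq_card => x; rewrite !inE.
by move=> x; rewrite !inE; apply/negP => /andP[+ /darc_not_uedge]; move=> ->.
Qed.

Lemma card_step_in y :
  #|[set s | step s y]| = undirected_degree y + #|[set s | darc s y]|.
Proof.
rewrite -cardsUI [X in _ = _ + X]eq_card0 ?addn0.
  by apply: eq_card => x; rewrite !inE uedge_sym.
by move=> x; rewrite !inE uedge_sym; apply/negP => /andP[+ /darc_not_uedge]; move=> ->.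
Qed.

Lemma card_split (P Q : pred G) :
  #|[set x | P x]| = #|[set x | P x & Q x]| + #|[set x | P x & ~~ Q x]|.
Proof.
rewrite -(cardsID [set x | Q x]); congr addn; apply: eq_card => x; rewrite !inE //.
by rewrite andbC.
Qed.

Lemma double_count (P : pred G) (Q : rel G) :
  \sum_y #|[set x | P x & Q x y]| = \sum_(x | P x) #|[set y | Q x y]|.
Proof.
under eq_bigr do rewrite -sum1dep_card.
rewrite (exchange_big_dep P) => [|? ? _ /andP[]] //=.
apply: eq_bigr => x Px; rewrite -sum1dep_card.
by apply: eq_bigl => y; rewrite Px.
Qed.

Section Regular.
Variables r z : nat.
Hypothesis und_eq : forall u, undirected_degree u = r.
Hypothesis out_eq : forall u, out_degree u = z.

Lemma indegree_bound u w b y : uedge u w -> darc w b ->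
  z + #|[set s | darc s y & s \in edge_ball u (k - 2)]| <=
  #|[set s | darc s y]| + unreached u y + unreached b y.
Proof.
move=> uw wb.
have far v : y \notin ball v k -> z <= #|[set s | darc s y]| + unreached v y.
  move=> /indegree_far; have := card_split (step v) (fun x => y \in ball x k.+1).
  rewrite card_step_out und_eq out_eq card_step_in und_eq -/(unreached v y); lia.
have := card_split (fun s => darc s y) (fun s => s \in edge_ball u (k - 2)).
set in_side := #|[set s | _ & _]|; set in_off := #|[set s | _ & ~~ _]| => in_split.
(* An arc from an end of an edge-first path of length at most k - 2 prolongs it to
   an edge-first path of length at most k - 1. *)
have in_side0 : y \notin edge_ball u k.-1 -> in_side = 0.
  move=> y_edge; apply: eq_card0 => s; rewrite inE; apply/negP => /andP[sy].
  move=> /edge_ballP[v [p [uv mp sE sp]]]; case/negP: y_edge; apply/edge_ballP.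
  exists v, (rcons p y); rewrite last_rcons size_rcons; split=> //; last by lia.
  by apply: (@mixed_path_rcons_darc u (v :: p)) => //=; rewrite sE.
have [y_edge|y_edge] := boolP (y \in edge_ball u k.-1).
  have := indegree_edge_side y_edge; rewrite -/in_off.
  have := card_split (darc u) (fun x => y \in ball x k.+1).
  rewrite -[#|[set x | darc u x]|]/(out_degree u) out_eq.
  have : #|[set x | darc u x & y \notin ball x k.+1]| <= unreached u y.
    by apply/subset_leq_card/subsetP => x; rewrite !inE /step => /andP[-> ->]; rewrite orbT.
  lia.
rewrite in_side0 // addn0.
have [y_ball|/far] := boolP (y \in ball u k); last by lia.
by have := far b (arc_side_far uw wb y_ball y_edge); lia.
Qed.


(** Summing [indegree_bound] over y; regularity makes the sum of the in-degrees
    exactly |G| z. *)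
Lemma excess_bound_regular u : 0 < r -> 0 < z ->
  full_tree r z k.+1 <= #|G| /\
  r * z * edge_tree r z (k - 2) <= 2 * (r + z) * (#|G| - full_tree r z k.+1).
Proof.
move=> r_gt0 z_gt0.
have und_ge v : r <= undirected_degree v by rewrite und_eq.
have out_ge v : z <= out_degree v by rewrite out_eq.
have ball_ge v : full_tree r z k.+1 <= #|ball v k.+1|.
  by rewrite card_ball; exact: (size_tree_paths und_ge out_ge k.+1 None).
split; first exact: leq_trans (ball_ge u) (max_card _).
set e := #|G| - _.
have sum_unreached v : \sum_y unreached v y <= (r + z) * e.
  rewrite (double_count (step v) (fun x y => y \notin ball x k.+1)).
  rewrite -(und_eq v) -(out_eq v) -card_step_out -sum_nat_cond_const.
  apply: leq_sum => x _; rewrite /e -(cardsC (ball x k.+1)).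
  rewrite -[X in X <= _](@eq_card _ (~: ball x k.+1)); last by move=> y; rewrite !inE.
  by have := ball_ge x; lia.
have [w uw] : exists w, uedge u w.
  have /card_gt0P[w] : 0 < undirected_degree u by rewrite und_eq.
  by rewrite inE; exists w.
have [b wb] : exists b, darc w b.
  have /card_gt0P[b] : 0 < out_degree w by rewrite out_eq.
  by rewrite inE; exists b.
have sum_arcs (P : pred G) :
    \sum_y #|[set s | P s & darc s y]| = #|[set s | P s]| * z.
  rewrite double_count (eq_bigr (fun=> z)) ?sum_nat_cond_const // => s _; exact: out_eq.
have sum_in : \sum_(y : G) #|[set s | darc s y]| = #|G| * z.
  by rewrite -cardsT -(sum_arcs predT); apply: eq_bigr => y _; apply: eq_card => s;
    rewrite !inE.
have sum_side : \sum_y #|[set s | darc s y & s \in edge_ball u (k - 2)]| =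
                #|edge_ball u (k - 2)| * z.
  rewrite -[#|edge_ball _ _|]cardsE -sum_arcs.
  by apply: eq_bigr => y _; apply: eq_card => s; rewrite !inE andbC.
have : \sum_y (z + #|[set s | darc s y & s \in edge_ball u (k - 2)]|) <=
       \sum_y (#|[set s | darc s y]| + unreached u y + unreached b y).
  by apply: leq_sum => y _; exact: indegree_bound uw wb.
rewrite !big_split /= sum_nat_const sum_in sum_side.
have := sum_unreached u; have := sum_unreached b.
have : r * edge_tree r z (k - 2) * z <= #|edge_ball u (k - 2)| * z.
  by rewrite leq_mul2r card_edge_ball ?leq_subr // size_edge_paths ?orbT.
rewrite [r * z * _]mulnAC -[2 * _ * e]mulnA (_ : #|xpredT| = #|G|); last exact: eq_card.
lia.
Qed.

End Regular.

(** One more edge or arc at u is the root of one more branch of the tree at u, of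
    size at least edge_tree k. *)
Lemma excess_bound_irregular r z u :
  (forall v, r <= undirected_degree v) -> (forall v, z <= out_degree v) ->
  (undirected_degree u != r) || (out_degree u != z) ->
  full_tree r z k.+1 + edge_tree r z k <= #|G|.
Proof.
move=> und_ge out_ge big_deg.
apply: leq_trans (leq_trans (size_root_paths und_ge out_ge k u) _); last first.
  by rewrite -card_ball max_card.
have := und_ge u; have := out_ge u; have := leq_edge_full_tree r z k.
rewrite [full_tree r z k.+1]/=; case/orP: big_deg => /eqP; nia.
Qed.

Lemma excess_bound r z : 0 < r -> 0 < z ->
  is_minimum (@undirected_degree G) r -> is_minimum (@out_degree G) z ->
  moore_bound r z k <= #|G| /\
  r * z * edge_tree r z (k - 2) <= (2 * r + 3 * z) * (#|G| - moore_bound r z k).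
Proof.
move=> r_gt0 z_gt0 [und_ge [u _]] [out_ge _]; rewrite moore_bound_full_tree //.
have [reg|] := boolP [forall v : G, (undirected_degree v == r) && (out_degree v == z)].
  have [] := @excess_bound_regular r z _ _ u r_gt0 z_gt0.
  - by move=> v; case/andP: (forallP reg v) => /eqP.
  - by move=> v; case/andP: (forallP reg v) => _ /eqP.
  by move=> ? bound; split=> //; apply: leq_trans bound _; rewrite leq_mul2r; lia.
rewrite negb_forall => /existsP[v]; rewrite negb_and.
move/(excess_bound_irregular und_ge out_ge) => bound.
split; first by lia.
apply: leq_trans (edge_tree_growth r z k) _; nia.
Qed.
End Geodetic.
End Paths.

(** * Closed form of the bound *)

Section ClosedForm.
Variables (R : fieldType) (r z : nat).
Local Open Scope ring_scope.

(** The partial geometric sums of x and of y satisfy the recurrence of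
    [edge_tree] up to their constant terms 1 + x and 1 + y, which differ by x - y;
    and they have m.+1 terms because the terms of exponent 0 cancel. *)
Lemma edge_tree_closed_form (x y : R) m : (0 < r)%N ->
  x + y = r%:R + z%:R - 1 -> x * y = - z%:R -> x != 1 -> y != 1 ->
  (x ^+ m.+1 - 1) / (x - 1) - (y ^+ m.+1 - 1) / (y - 1) = (x - y) * (edge_tree r z m)%:R.
Proof.
move=> r_gt0 xDy xMy x1 y1.
have geom (t : R) n : t != 1 -> (t ^+ n - 1) / (t - 1) = \sum_(i < n) t ^+ i.
  by move=> t1; rewrite subrX1 mulrC mulKf // subr_eq0.
rewrite !geom // {x1 y1 geom}.
have root (t u : R) : t + u = r%:R + z%:R - 1 -> t * u = - z%:R ->
    t ^+ 2 = (r%:R + z%:R - 1) * t + z%:R.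
  by move=> <- tu; rewrite -[z%:R]opprK -tu; ring.
have xx := root x y xDy xMy.
have yy : y ^+ 2 = (r%:R + z%:R - 1) * y + z%:R by apply: (root y x); rewrite 1?addrC 1?mulrC.
have geom2 (t : R) n : t ^+ 2 = (r%:R + z%:R - 1) * t + z%:R ->
  \sum_(i < n.+3) t ^+ i = 1 + t + (r%:R + z%:R - 1) * (\sum_(i < n.+2) t ^+ i - 1)
                            + z%:R * \sum_(i < n.+1) t ^+ i.
  move=> tt; rewrite big_ord_recl [X in _ + X]big_ord_recl [\sum_(i < n.+2) _]big_ord_recl /=.
  under eq_bigr do rewrite !exprS mulrA -expr2 tt.
  under [\sum_(i < n.+1) t ^+ (bump 0 i)]eq_bigr do rewrite exprS.
  by rewrite -!mulr_sumr; ring.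
have [] : \sum_(i < m.+1) x ^+ i - \sum_(i < m.+1) y ^+ i = (x - y) * (edge_tree r z m)%:R /\
  \sum_(i < m.+2) x ^+ i - \sum_(i < m.+2) y ^+ i = (x - y) * (edge_tree r z m.+1)%:R.
  elim: m => [|m [IH1 IH2]].
    split; first by rewrite !big_ord1 subrr mulr0.
    by rewrite !big_ord_recl !big_ord0 /= !muln0 !addn0; ring.
  split=> //; rewrite !geom2 //.
  set a := r%:R + z%:R - 1; set X2 := \sum_(i < _) x ^+ i; set Y2 := \sum_(i < _) y ^+ i.
  set X1 := \sum_(i < m.+1) x ^+ i in IH1 *; set Y1 := \sum_(i < m.+1) y ^+ i in IH1 *.
  transitivity ((x - y) + a * (X2 - Y2) + z%:R * (X1 - Y1)); first by ring.
  rewrite IH1 IH2 edge_tree_rec // !natrD !natrM natrB ?natrD -/a; first by ring.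
  by rewrite addn_gt0 r_gt0.
by [].
Qed.
End ClosedForm.

Local Open Scope ring_scope.

Theorem theorem15 (R : realType) (r z k : nat)
    (hr : (1 <= r)%N) (hz : (1 <= z)%N) (hk : (1 <= k)%N)
    (eps : int) (G : mixedGraph) (hG : is_cage r z k eps G) :
  let phi : R := Num.sqrt ((r%:R + z%:R - 1) ^+ 2 + 4 * z%:R) in
  let lambda1 : R := 1 / 2 * (r%:R + z%:R - 1 + phi) in
  let lambda2 : R := 1 / 2 * (r%:R + z%:R - 1 - phi) in
  eps%:~R >=
    r%:R * z%:R / ((2 * r%:R + 3 * z%:R) * phi)
    * ((lambda1 ^+ (k - 1) - 1) / (lambda1 - 1)
       - (lambda2 ^+ (k - 1) - 1) / (lambda2 - 1)).
Proof.
lazy zeta; set phi := Num.sqrt _; set lambda1 := 1 / 2 * (_ + phi).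
set lambda2 := 1 / 2 * (_ - phi).
have [[geoG min_und min_out card_G] _] := hG.
have [moore_le bound] := excess_bound geoG hr hz min_und min_out.
have -> : eps = (#|G| - moore_bound r z k)%N%:Z by lia.
have r1 : 1 <= r%:R :> R by rewrite ler1n.
have z1 : 1 <= z%:R :> R by rewrite ler1n.
have phi2 : phi ^+ 2 = (r%:R + z%:R - 1) ^+ 2 + 4 * z%:R.
  by rewrite sqr_sqrtr //; have := sqr_ge0 (r%:R + z%:R - 1 : R); lra.
have phi_gt0 : 0 < phi.
  by rewrite sqrtr_gt0; have := sqr_ge0 (r%:R + z%:R - 1 : R); lra.
have lam_sum : lambda1 + lambda2 = r%:R + z%:R - 1 by rewrite /lambda1 /lambda2; field.
have lam_mul : lambda1 * lambda2 = - z%:R.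
  have -> : lambda1 * lambda2 = ((r%:R + z%:R - 1) ^+ 2 - phi ^+ 2) / 4.
    by rewrite /lambda1 /lambda2; field.
  by rewrite phi2; field.
have lam_neq1 (x y : R) : x + y = r%:R + z%:R - 1 -> x * y = - z%:R -> x != 1.
  by move=> xDy xMy; apply/eqP => x1; move: xDy xMy; rewrite x1 mul1r; lra.
have [k1|k_ge2] := leqP k 1.
  have -> : (k - 1 = 0)%N by lia.
  by rewrite !expr0 subrr !mul0r subrr mulr0.
have -> : (k - 1 = (k - 2).+1)%N by lia.
rewrite (edge_tree_closed_form _ hr lam_sum lam_mul); last 2 first.
- exact: lam_neq1 lam_sum lam_mul.
- by apply: (lam_neq1 _ lambda1); rewrite 1?addrC 1?mulrC.
have -> : lambda1 - lambda2 = phi by rewrite /lambda1 /lambda2; field.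
move: bound; rewrite -(ler_nat R) !natrM natrD !natrM => bound.
set D := 2 * r%:R + 3 * z%:R in bound *.
have D_gt0 : 0 < D by rewrite /D; lra.
rewrite -pmulrn [leLHS](_ : _ = r%:R * z%:R * (edge_tree r z (k - 2))%:R / D).
  by rewrite ler_pdivrMr // mulrC [leRHS]mulrC mulrC.
by field; rewrite !gt_eqF.
Qed.
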